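(* Let $\lambda=(\lambda_1,\dots,\lambda_\ell)$ be a partition of length $\ell$, let $\mathbf{x}=(x_1,\dots,x_n)$ and $\mathbf{t}=(t_1,\dots,t_{\ell-1})$ be commuting indeterminates, and let $1\le i\le \ell-1$. Suppose $\lambda_i=\lambda_{i+1}$. Then the refined dual Grothendieck polynomial $g_\lambda(\mathbf{x};\mathbf{t})$ is symmetric in $t_{i-1}$ and $t_i$, where (in the case $i=1$) one can take $t_0=x_j$ for any $1\le j<\ell$ with $j\le n$.
   Context: A reverse plane partition of shape $\lambda$ (English convention, row 1 at the top) is a filling of the boxes of $\lambda$ with positive integers that weakly increases along rows and down columns. Let $\mathrm{RPP}^n(\lambda)$ be the set of those with all entries at most $n$. For $T\in\mathrm{RPP}^n(\lambda)$, let $a_i$ be the number of columns of $T$ containing $i$, and let $b_r$ be the number of boxes in row $r$ whose entry equals the entry in the box directly below. The refined dual Grothendieck polynomial is $g_\lambda(\mathbf{x};\mathbf{t}):=\sum_{T\in\mathrm{RPP}^n(\lambda)}\prod_{r}t_r^{b_r}\prod_{i}x_i^{a_i}$. ''Symmetric in two variables'' means invariant under exchanging them. *)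

(* Defs.v *)
From mathcomp Require Import all_boot all_order all_fingroup all_algebra.
From mathcomp.multinomials Require Export mpoly.

Set Implicit Arguments.
Unset Strict Implicit.
Unset Printing Implicit Defensive.

Import GRing.Theory.

Local Open Scope ring_scope.

(* Everything is indexed from 0: rows, columns, entries (the value k : 'I_n
   stands for the entry k + 1) and variables ([xvar k] is x_(k+1), [tvar r] is
   t_(r+1)). *)

(* A partition has positive parts, so its length is [size la]. *)
Definition is_partition (la : seq nat) : bool :=
  sorted geq la && (0%N \notin la).

Section RefinedDualGrothendieck.

Variables (la : seq nat) (n : nat).

Definition box : finType := {r : 'I_(size la) & 'I_(nth 0%N la r)}.

Definition row_of (b : box) : nat := tag b.
Definition col_of (b : box) : nat := tagged b.

Definition filling := {ffun box -> 'I_n}.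

Definition is_rpp (T : filling) : bool :=
  [forall b : box, forall c : box,
     ((row_of b == row_of c) && (col_of b <= col_of c)%N ==> (T b <= T c)%N)
  && ((col_of b == col_of c) && (row_of b <= row_of c)%N ==> (T b <= T c)%N)].

(* A partition has [head 0 la] nonempty columns. *)
Definition cols_containing (T : filling) (k : 'I_n) : nat :=
  #|[set c : 'I_(head 0%N la) |
       [exists b : box, (col_of b == c) && (T b == k)]]|.

Definition equal_below (T : filling) (r : nat) : nat :=
  #|[set b : box | (row_of b == r) &&
       [exists c : box,
          [&& row_of c == r.+1, col_of c == col_of b & T c == T b]]]|.

Definition nvars : nat := (n + (size la).-1)%N.

Definition xidx (k : 'I_n) : 'I_nvars := lshift (size la).-1 k.
Definition tidx (r : 'I_(size la).-1) : 'I_nvars := rshift n r.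

Definition xvar (k : 'I_n) : {mpoly int[nvars]} := 'X_(xidx k).
Definition tvar (r : 'I_(size la).-1) : {mpoly int[nvars]} := 'X_(tidx r).

(* No box of the last row has a box below it, so t_1, ..., t_(l-1) suffice. *)
Definition refined_dual_grothendieck : {mpoly int[nvars]} :=
  \sum_(T : filling | is_rpp T)
     (\prod_(r < (size la).-1) tvar r ^+ equal_below T r)
   * (\prod_(k < n) xvar k ^+ cols_containing T k).

End RefinedDualGrothendieck.

Arguments xidx la [n] k.
Arguments tidx [la] n r.

Definition symmetric_in (N : nat) (u v : 'I_N) (p : {mpoly int[N]}) : Prop :=
  msym (tperm u v) p = p.

(* Main.v *)
Require Import Defs.
From mathcomp Require Import all_boot all_order all_fingroup all_algebra.
From mathcomp Require Import zify ring.

(* Let a <= b be weakly increasing sequences, and let y range over the weakly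
   increasing sequences with a <= y <= b.  Give y_c the weight t if y_c = a_c,
   t' if y_c = b_c, and z_(y_c) strictly in between (a constant if a_c = b_c).
   Then the total weight is symmetric in t and t': by inclusion-exclusion on the
   descents of y, it is a combination of sums over strictly decreasing runs
   y_1 > ... > y_k, and such a run takes its values in [a_k, b_1], so these sums
   are elementary symmetric polynomials in t, t' and the z_j with a_k < j < b_1.

   This is applied twice.  If rows i and i+1 have the same length, fix all rows
   of a reverse plane partition but row i, which then runs between its two
   neighbours; this exchanges t_(i-1) and t_i, where the row above the first one
   is read as constant equal to the least entry, with t_0 = x_1.  On the other
   hand, fix the cells filled with k or k+1, and let y_c be the number of entries
   k+1 at the bottom of column c; this exchanges x_k and x_(k+1), up to
   denominators t_r.  Conjugating x_1 <-> t_1 by the latter gives x_j <-> t_1. *)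

Set Implicit Arguments.
Unset Strict Implicit.
Unset Printing Implicit Defensive.

(** * Bounded chains: exchanging the weights of the two bounds *)

Section BoundedChains.

Import GRing.Theory.
Local Open Scope ring_scope.

Variables (R : comPzRingType) (N : nat) (z : nat -> R) (d : R).

Definition end_weight (t t' : R) (a b v : nat) : R :=
  if a == b then d else if v == a then t else if v == b then t' else z v.

Fixpoint chain_sum (t t' : R) (m : nat) (a b : nat -> nat) (lo : nat) : R :=
  if m is m'.+1 then
    \sum_(v < N | (a 0 <= v <= b 0)%N && (lo <= v)%N)
       end_weight t t' (a 0%N) (b 0%N) v * chain_sum t t' m' (a \o succn) (b \o succn) v
  else 1.

(** The factor [g] will be the weight of a strictly decreasing run of earlier terms that ends above
    the first term summed here; from that term on the sequence weakly increases. *)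
Definition headed_sum (t t' : R) (m : nat) (a b : nat -> nat) (g : nat -> R) : R :=
  \sum_(v < N | (a 0 <= v <= b 0)%N)
     end_weight t t' (a 0%N) (b 0%N) v * g v * chain_sum t t' m (a \o succn) (b \o succn) v.

(** The elementary symmetric polynomial of degree [k] in the [z j] with [v < j < B] and [j < N]. *)
Fixpoint elem_sym (B k v : nat) : R :=
  if k is k'.+1 then \sum_(j < N | (v < j < B)%N) z j * elem_sym B k' j else 1.

(* The sum over [B >= y_1 > ... > y_k > v] of the product of the weights, where
   the value [B] has weight [t'] and any other value [j] has weight [z j]. *)
Definition descent_sum (t' : R) (B k v : nat) : R :=
  if k is k'.+1 then
    if (v < B)%N then elem_sym B k v + t' * elem_sym B k' v else 0
  else 1.

(** The term [j] prolongs the run downwards. As [j > v >= a], the weight [t] never occurs. As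
    [B <= b], the value [b] is possible only for the first term of a run, whence the condition
    [B = b] for [k = 0]. *)
Lemma descent_sumS (t t' : R) (a b B k v : nat) :
  (a <= b < N)%N -> (B <= b)%N -> (k = 0 -> B = b)%N -> (a <= v)%N ->
  \sum_(j < N | (a <= j <= b)%N && (v < j)%N) end_weight t t' a b j * descent_sum t' B k j
  = descent_sum t' B k.+1 v.
Proof.
move=> /andP[ab bN] Bb kB av; have [vB|Bv] := ltnP v B; last first.
  rewrite /= ltnNge Bv /=; apply: big1 => j /andP[/andP[aj jb] vj].
  case: k kB => [|k] kB; first by rewrite kB // in Bv; lia.
  by rewrite /= ltnNge (leq_trans Bv (ltnW vj)) mulr0.
have abN : (a == b) = false by lia.
case: k kB => [|k] kB.
  have {}kB := kB erefl; subst B; rewrite /= vB.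
  rewrite (bigD1 (Ordinal bN)) /=; last by rewrite ab leqnn vB.
  rewrite /end_weight abN eqxx eq_sym abN addrC; congr (_ + _).
  apply: eq_big => j; first by rewrite -val_eqE /=; lia.
  move=> /andP[/andP[/andP[aj jb] vj]]; rewrite -val_eqE /= => jb'.
  by rewrite (negbTE jb') ifN //; lia.
rewrite [RHS]/= vB /= mulr_sumr -big_split /=.
rewrite (bigID (fun j : 'I_N => (j < B)%N)) /= [X in _ + X]big1 ?addr0; last first.
  by move=> j /andP[_ /negbTE->]; rewrite mulr0.
apply: eq_big => j; first by lia.
move=> /andP[/andP[_ vj] jB]; rewrite jB /end_weight abN !ifN; [ring|lia|lia].
Qed.

(** The inclusion-exclusion step: a lower bound on the first term becomes no condition minus a
    descent. *)
Lemma chain_sum_split (t t' : R) (m : nat) (a b : nat -> nat) (v : nat) :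
  chain_sum t t' m.+1 a b v = chain_sum t t' m.+1 a b 0 -
    \sum_(j < N | (a 0 <= j <= b 0)%N && (j < v)%N)
       end_weight t t' (a 0%N) (b 0%N) j * chain_sum t t' m (a \o succn) (b \o succn) j.
Proof.
rewrite /= [in RHS](bigID (fun j : 'I_N => (v <= j)%N)) /=.
rewrite [X in _ = _ + X - _](eq_bigl (fun j : 'I_N =>
  (a 0 <= j <= b 0)%N && (j < v)%N)); last first.
  by move=> j; rewrite -ltnNge leq0n andbT.
by rewrite addrK; apply: eq_bigl => j; rewrite leq0n andbT.
Qed.

(** For [a < B], with e_j the elementary symmetric polynomials in the [z] strictly between [a] and
    [B], both sides are e_(k+1) + (t + t') e_k + t t' e_(k-1). Otherwise they vanish, or equal [d]
    if [k = 0]. *)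
Lemma sum_descent_sumC (t t' : R) (a b B k : nat) :
  (a <= b < N)%N -> (B <= b)%N -> (k = 0 -> B = b)%N ->
  \sum_(v < N | (a <= v <= b)%N) end_weight t t' a b v * descent_sum t' B k v =
  \sum_(v < N | (a <= v <= b)%N) end_weight t' t a b v * descent_sum t B k v.
Proof.
move=> /andP[ab bN] Bb kB; have aN := leq_ltn_trans ab bN.
(* Only the term at [v = a] can have weight [u]; the others prolong the run. *)
have first u u' : \sum_(v < N | (a <= v <= b)%N) end_weight u u' a b v * descent_sum u' B k v
    = end_weight u u' a b a * descent_sum u' B k a + descent_sum u' B k.+1 a.
  rewrite -(descent_sumS u u' (a := a) (b := b)) ?ab //.
  rewrite (bigD1 (Ordinal aN)) /= ?leqnn ?ab //; congr (_ + _).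
  by apply: eq_bigl => j; rewrite -val_eqE /=; lia.
rewrite !first /end_weight eqxx; case: eqP => [ab'|/eqP ab'].
  have aB : (a < B)%N = false by lia.
  by rewrite /= aB !addr0; case: (k) => //= k'; rewrite aB.
case: k kB {first} => [|k] kB /=.
  by rewrite kB // (_ : (a < b)%N); [ring|lia].
by case: ifP => _; ring.
Qed.

(** Monotone bounds confine [t] to the last term of a run, since y_i > y_(i+1) >= a_(i+1) >= a_i,
    and [t'] to its first term, whose upper bound is at most the later ones. *)
Lemma headed_sumC (t t' : R) (m : nat) (a b : nat -> nat) (B k : nat) :
  {homo a : i j / (i <= j)%N} -> (forall i, i <= m -> a i <= b i < N)%N ->
  {homo b : i j / (i <= j)%N} -> (B <= b 0)%N -> (k = 0 -> B = b 0)%N ->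
  headed_sum t t' m a b (descent_sum t' B k) = headed_sum t' t m a b (descent_sum t B k).
Proof.
move=> + + + ; elim: m a b B k => [|m IHm] a b B k amono abN bmono Bb kB.
  rewrite /headed_sum /= (eq_bigr _ (fun _ _ => mulr1 _)).
  by rewrite [RHS](eq_bigr _ (fun _ _ => mulr1 _)) sum_descent_sumC ?abN.
(* Without the comparison of the first two terms, the run ends at the first one and the second
   starts a new chain with an empty run. The correction, where the first exceeds the second, adds
   the first term to the run. *)
have tail u u' : headed_sum u u' m.+1 a b (descent_sum u' B k) =
   (\sum_(v < N | (a 0 <= v <= b 0)%N) end_weight u u' (a 0%N) (b 0%N) v * descent_sum u' B k v)
    * headed_sum u u' m (a \o succn) (b \o succn) (descent_sum u' (b 1%N) 0)
   - headed_sum u u' m (a \o succn) (b \o succn) (descent_sum u' B k.+1).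
  rewrite /headed_sum; under eq_bigr do rewrite chain_sum_split mulrBr.
  rewrite sumrB -mulr_suml; congr (_ * _ - _).
    by apply: eq_big => j; rewrite /= ?andbT // mulr1.
  under eq_bigr do rewrite mulr_sumr.
  rewrite (exchange_big_dep (fun j : 'I_N => (a 1%N <= j <= b 1%N)%N)) /=; last first.
    by move=> i j _ /andP[].
  apply: eq_bigr => j /andP[aj jb].
  rewrite -[X in _ * X * _]/(descent_sum u' B k.+1 j).
  rewrite -(descent_sumS u u' (a := a 0%N) (b := b 0%N)) ?abN //; last first.
    exact: leq_trans (amono 0%N 1%N _) aj.
  rewrite mulr_sumr mulr_suml; apply: eq_big => [i|i _]; first by rewrite aj jb.
  by ring.
rewrite !tail sum_descent_sumC ?abN //; congr (_ * _ - _); apply: IHm => //=.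
- by move=> i j ij; exact: amono.
- by move=> i im; exact: abN.
- by move=> i j ij; exact: bmono.
- by move=> i j ij; exact: amono.
- by move=> i im; exact: abN.
- by move=> i j ij; exact: bmono.
- exact: leq_trans Bb (bmono 0%N 1%N _).
Qed.

Lemma chain_sumC (t t' : R) (m : nat) (a b : nat -> nat) :
  {homo a : i j / (i <= j)%N} -> {homo b : i j / (i <= j)%N} ->
  (forall i, i < m -> a i <= b i < N)%N ->
  chain_sum t t' m a b 0 = chain_sum t' t m a b 0.
Proof.
move=> amono bmono abN; case: m abN => [//|m] abN.
have E u u' : chain_sum u u' m.+1 a b 0 = headed_sum u u' m a b (descent_sum u' (b 0%N) 0).
  by apply: eq_big => j; rewrite /= ?andbT // mulr1.
by rewrite !E headed_sumC.
Qed.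

Lemma sum_ffunS (A : finType) (m : nat) (F : {ffun 'I_m.+1 -> A} -> R) :
  \sum_y F y =
  \sum_(v : A) \sum_(y : {ffun 'I_m -> A}) F [ffun i => oapp y v (unlift ord0 i)].
Proof.
rewrite pair_bigA /=.
rewrite (reindex (fun p : A * {ffun 'I_m -> A} =>
  [ffun i => oapp p.2 p.1 (unlift ord0 i)])) //=.
exists (fun y => (y ord0, [ffun j => y (lift ord0 j)])) => [[v y]|y] _ /=.
  rewrite ffunE unlift_none /=; congr (_, _).
  by apply/ffunP => j; rewrite !ffunE liftK.
apply/ffunP => j; rewrite ffunE; case: unliftP => [j'|] -> //=.
by rewrite ffunE.
Qed.

Definition bounded_chain (m : nat) (a b : nat -> nat) (y : {ffun 'I_m -> 'I_N}) : bool :=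
  [forall c : 'I_m, a c <= y c <= b c]%N &&
  [forall c : 'I_m, forall c' : 'I_m, (c <= c')%N ==> (y c <= y c')%N].

Lemma bounded_chain_cons (m : nat) (a b : nat -> nat) (lo : nat) (v : 'I_N)
    (y : {ffun 'I_m -> 'I_N}) (y' := [ffun i => oapp y v (unlift ord0 i)]) :
  bounded_chain a b y' && [forall c, (lo <= y' c)%N] =
  [&& (a 0 <= v <= b 0)%N && (lo <= v)%N, bounded_chain (a \o succn) (b \o succn) y
    & [forall c, (v <= y c)%N]].
Proof.
have y0 : y' ord0 = v by rewrite ffunE unlift_none.
have yS j : y' (lift ord0 j) = y j by rewrite ffunE liftK.
apply/idP/idP.
  move=> /andP[/andP[/forallP yab /forallP ymono] /forallP lo_y].
  have := yab ord0; have := lo_y ord0; rewrite y0 /= => -> -> /=.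
  apply/andP; split; first (apply/andP; split); apply/forallP => c.
  - by have := yab (lift ord0 c); rewrite yS.
  - by apply/forallP => c'; have /forallP/(_ (lift ord0 c')) := ymono (lift ord0 c); rewrite !yS.
  - by have /forallP/(_ (lift ord0 c)) := ymono ord0; rewrite y0 yS.
move=> /and3P[/andP[vab lo_v] /andP[/forallP yab /forallP ymono] /forallP v_y].
apply/andP; split; first (apply/andP; split); apply/forallP => c.
- by case: (unliftP ord0 c) => [j|] ->; rewrite ?yS ?y0 //; exact: yab.
- apply/forallP => c'; apply/implyP.
  case: (unliftP ord0 c) => [j|] ->; case: (unliftP ord0 c') => [j'|] ->;
    rewrite ?yS ?y0 //.
  by have /forallP/(_ j')/implyP := ymono j; rewrite !lift0.
- case: (unliftP ord0 c) => [j|] ->; rewrite ?yS ?y0 //.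
  exact: leq_trans lo_v (v_y j).
Qed.

Lemma sum_bounded_chain_lo (t t' : R) (m : nat) (a b : nat -> nat) (lo : nat) :
  \sum_(y : {ffun 'I_m -> 'I_N} | bounded_chain a b y && [forall c, (lo <= y c)%N])
     \prod_(c < m) end_weight t t' (a c) (b c) (y c) = chain_sum t t' m a b lo.
Proof.
elim: m a b lo => [|m IHm] a b lo.
  rewrite (big_pred1 (ffun0 (card_ord 0))) => [|y].
    by rewrite big_ord0.
  rewrite /= /bounded_chain (introT eqP _); last by apply/ffunP => -[].
  by apply/andP; split; first (apply/andP; split); apply/forallP => -[].
rewrite big_mkcond sum_ffunS /= [RHS]big_mkcond; apply: eq_bigr => v _.
under eq_bigr do rewrite bounded_chain_cons.
rewrite -IHm; case: ifP => _ /=; last by rewrite big1.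
rewrite -big_mkcond mulr_sumr; apply: eq_bigr => y _.
rewrite big_ord_recl ffunE unlift_none; congr (_ * _).
by apply: eq_bigr => c _; rewrite ffunE liftK.
Qed.

Lemma sum_bounded_chainC (t t' : R) (m : nat) (a b : nat -> nat) :
  {homo a : i j / (i <= j)%N} -> {homo b : i j / (i <= j)%N} ->
  (forall i, i < m -> a i <= b i < N)%N ->
  \sum_(y : {ffun 'I_m -> 'I_N} | bounded_chain a b y)
     \prod_(c < m) end_weight t t' (a c) (b c) (y c) =
  \sum_(y : {ffun 'I_m -> 'I_N} | bounded_chain a b y)
     \prod_(c < m) end_weight t' t (a c) (b c) (y c).
Proof.
move=> amono bmono abN.
have lo0 (y : {ffun 'I_m -> 'I_N}) :
    bounded_chain a b y = bounded_chain a b y && [forall c, (0 <= y c)%N].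
  by symmetry; rewrite andb_idr // => _; apply/forallP.
by rewrite !(eq_bigl _ _ lo0) !sum_bounded_chain_lo chain_sumC.
Qed.

End BoundedChains.

(** * Entries on all positions, and the statistics read by columns *)

Section Entries.

Variables (la : seq nat) (n : nat).
Hypothesis la_part : is_partition la.

Implicit Types (T : filling la n) (b : box la).

Lemma part_anti r r' : r <= r' -> nth 0 la r' <= nth 0 la r.
Proof.
move=> rr'; have [r'l|lr'] := ltnP r' (size la); last by rewrite nth_default.
have /andP[la_sorted _] := la_part.
apply: (sorted_leq_nth (leT := geq)) => //=; last by rewrite inE (leq_ltn_trans rr').
- by move=> x y z /= yx xz; exact: leq_trans xz yx.
- by move=> x /=.
Qed.

Lemma part_le_head r : nth 0 la r <= head 0 la.
Proof. by rewrite -nth0 part_anti. Qed.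

Lemma col_lt b : col_of b < nth 0 la (row_of b).
Proof. exact: ltn_ord. Qed.

Lemma box_inj b b' : row_of b = row_of b' -> col_of b = col_of b' -> b = b'.
Proof.
case: b b' => r c [r' c']; rewrite /row_of /col_of /= => /val_inj rr'.
by subst r' => /val_inj->.
Qed.

Lemma box_at r c : c < nth 0 la r -> {b : box la | row_of b = r & col_of b = c}.
Proof.
move=> cr; have rl : r < size la by rewrite ltnNge; apply: contraTN cr => lr; rewrite nth_default.
by exists (Tagged (fun r : 'I_(size la) => 'I_(nth 0 la r)) (i := Ordinal rl) (Ordinal cr)).
Qed.

(* Positions outside the shape get the entry [n], larger than all others, so that
   [entry T] is monotone on all positions. *)
Definition entry T (r c : nat) : nat :=
  if [pick b : box la | (row_of b == r) && (col_of b == c)] is Some b then T b else n.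

Lemma entry_box T b : entry T (row_of b) (col_of b) = T b.
Proof.
rewrite /entry; case: pickP => [b' /andP[/eqP rr /eqP cc]|/(_ b)].
  by rewrite (box_inj rr cc).
by rewrite !eqxx.
Qed.

Lemma entry_lt T r c : (entry T r c < n) = (c < nth 0 la r).
Proof.
apply/idP/idP => [|/box_at[b <- <-]]; last by rewrite entry_box.
rewrite /entry; case: pickP => [b /andP[/eqP<- /eqP<-] _|]; first exact: col_lt.
by rewrite ltnn.
Qed.

Lemma entry_out T r c : nth 0 la r <= c -> entry T r c = n.
Proof.
rewrite leqNgt => cr; rewrite /entry; case: pickP => // b /andP[/eqP rb /eqP cb].
by rewrite -cb -rb col_lt in cr.
Qed.

Lemma entry_le T r c : entry T r c <= n.
Proof. by case: (ltnP c (nth 0 la r)) => [|/entry_out->//]; rewrite -(entry_lt T) => /ltnW. Qed.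

Lemma eq_entry T T' : (forall r c, c < nth 0 la r -> entry T r c = entry T' r c) -> T = T'.
Proof.
by move=> eqTT'; apply/ffunP => b; apply: val_inj; rewrite /= -!entry_box eqTT' ?col_lt.
Qed.

Lemma rppP T :
  reflect (forall r r' c c', r <= r' -> c <= c' -> entry T r c <= entry T r' c') (is_rpp T).
Proof.
apply: (iffP forallP) => [rppT|monoT b].
  move=> r r' c c' rr' cc'; have [cr'|] := ltnP c' (nth 0 la r'); last first.
    by move=> /(entry_out T)->; exact: entry_le.
  have cr : c < nth 0 la r by rewrite (leq_ltn_trans cc') // (leq_trans cr') ?part_anti.
  have [b rb cb] := box_at cr.
  (* The corner in row [r] and column [c'] lies in the shape because the parts decrease; it joins a
     step along a row to a step down a column. *)
  have [b1 rb1 cb1] := box_at (leq_trans cr' (part_anti rr')).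
  have [b' rb' cb'] := box_at cr'.
  have le1 : T b <= T b1.
    by have /forallP/(_ b1)/andP[/implyP-> //] := rppT b; rewrite rb rb1 cb cb1 eqxx cc'.
  have le2 : T b1 <= T b'.
    by have /forallP/(_ b')/andP[_ /implyP-> //] := rppT b1; rewrite cb' cb1 rb' rb1 eqxx rr'.
  by rewrite -{1}rb -{1}cb -rb' -cb' !entry_box (leq_trans le1).
apply/forallP => b'; rewrite -!entry_box; apply/andP; split; apply/implyP.
  by move=> /andP[/eqP-> cc']; exact: monoT.
by move=> /andP[/eqP-> rr']; exact: monoT.
Qed.

Lemma cols_containingE T k :
  cols_containing T k =
  #|[set c : 'I_(head 0 la) | [exists r : 'I_(size la), entry T r c == k]]|.
Proof.
apply: eq_card => c; rewrite !inE; apply/existsP/existsP => [[b /andP[/eqP<- /eqP<-]]|[r /eqP rc]].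
  by exists (tag b); rewrite entry_box.
have [b rb cb] : {b : box la | row_of b = r & col_of b = c}.
  by apply: box_at; rewrite -(entry_lt T) rc.
by exists b; rewrite cb eqxx -val_eqE /= -entry_box rb cb rc eqxx.
Qed.

(** Boxes of row [r] correspond to their columns. Two positions outside the shape both read [n]; the
    condition [< n] discards them. *)
Lemma equal_belowE T r :
  equal_below T r =
  #|[set c : 'I_(head 0 la) | (entry T r c == entry T r.+1 c) && (entry T r.+1 c < n)]|.
Proof.
pose hcol b : 'I_(head 0 la) := Ordinal (leq_trans (col_lt b) (part_le_head _)).
rewrite /equal_below -(card_in_imset (f := hcol)); last first.
  move=> b b'; rewrite !inE => /andP[/eqP rb _] /andP[/eqP rb' _] /(congr1 val) /= cc.
  by apply: box_inj => //; rewrite rb rb'.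
apply: eq_card => c; apply/imsetP/idP => [[b]|].
  rewrite inE => /andP[/eqP rb /existsP[b' /and3P[/eqP rb' /eqP cb' /eqP bb']]] ->.
  have eb : entry T r (col_of b) = T b by rewrite -rb entry_box.
  have eb' : entry T r.+1 (col_of b) = T b' by rewrite -rb' -cb' entry_box.
  by rewrite inE /= eb eb' bb' eqxx ltn_ord.
rewrite inE => /andP[/eqP ee]; rewrite entry_lt => /box_at[b' rb' cb'].
have [b rb cb] : {b : box la | row_of b = r & col_of b = c}.
  by apply: box_at; rewrite -(entry_lt T) ee -rb' -cb' entry_box.
exists b; last by apply: val_inj; rewrite /= cb.
rewrite inE rb eqxx /=; apply/existsP; exists b'.
by rewrite rb' cb' cb !eqxx -val_eqE /= -!entry_box rb cb rb' cb' ee eqxx.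
Qed.

End Entries.

(** * The weight of a single column, cell by cell *)

Section ColumnWeight.

Import GRing.Theory.
Local Open Scope ring_scope.

Variables (R : comPzRingType) (n : nat) (xx tt : nat -> R).

(* [tt r] is the weight of an equality between rows [r.-1] and [r]. *)
Definition step_weight (E : nat -> nat) (r : nat) : R :=
  if (n <= E r)%N then 1 else if (0 < r)%N && (E r.-1 == E r) then tt r else xx (E r).

(** A cell of a weakly increasing column either repeats the one above and pays [tt], or is the first
    occurrence of its entry and pays [xx]. The induction adds the bottom cell. *)
Lemma prod_step_weight (l : nat) (E : nat -> nat) :
  {homo E : r r' / (r <= r')%N} ->
  (\prod_(r < l.-1) if (E r == E r.+1) && (E r.+1 < n)%N then tt r.+1 else 1) *
  (\prod_(k < n) if [exists r : 'I_l, E r == k] then xx k else 1) =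
  \prod_(r < l) step_weight E r.
Proof.
move=> monoE; elim: l => [|l IHl].
  rewrite !big_ord0 mul1r big1 // => k _.
  by case: existsP => // -[[]].
rewrite big_ord_recr /= -IHl.
have existsS k : [exists r : 'I_l.+1, E r == k] = [exists r : 'I_l, E r == k] || (E l == k).
  apply/existsP/orP => [[r]|[/existsP[r Er]|El]].
  - have [rl|] := ltnP r l; first by left; apply/existsP; exists (Ordinal rl).
    by rewrite leq_eqVlt ltnNge -ltnS ltn_ord orbF => /eqP<-; right.
  - by exists (widen_ord (leqnSn l) r).
  - by exists ord_max.
rewrite [X in _ * X = _](eq_bigr (fun k : 'I_n =>
  if [exists r : 'I_l, E r == k] || (E l == k) then xx k else 1)); last first.
  by move=> k _; rewrite existsS.
rewrite /step_weight; case: (boolP ((0 < l)%N && (E l.-1 == E l))) => [/andP[l0 El]|newl].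
  case: l l0 El {IHl} existsS => // l _ /= El existsS.
  rewrite big_ord_recr /= El mulrAC ltnNge; congr (_ * _ * _); last by case: (n <= _)%N.
  apply: eq_bigr => k _; rewrite orb_idr // => /eqP Ek.
  by apply/existsP; exists ord_max; rewrite /= (eqP El) Ek.
have -> : \prod_(r < l) (if (E r == E r.+1) && (E r.+1 < n)%N then tt r.+1 else 1)
    = \prod_(r < l.-1) (if (E r == E r.+1) && (E r.+1 < n)%N then tt r.+1 else 1).
  case: l newl {IHl existsS} => // l /= newl.
  by rewrite big_ord_recr /= (negbTE newl) mulr1.
rewrite -mulrA; congr (_ * _).
have -> : (if (n <= E l)%N then 1 else xx (E l)) = \prod_(k < n) if E l == k then xx k else 1.
  have [nE|En] := leqP n (E l).
    rewrite big1 // => k _; rewrite ifN //; apply: contraTneq nE => ->.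
    by rewrite -ltnNge.
  rewrite (bigD1 (Ordinal En)) //= eqxx big1 ?mulr1 // => k.
  by rewrite -val_eqE eq_sym /= => /negbTE->.
rewrite -big_split; apply: eq_bigr => k _ /=.
case: existsP => [[r /eqP Er]|_]; last by rewrite mul1r.
(* An earlier occurrence of [E l] would by monotonicity force equality with the cell just above,
   against [newl]. *)
rewrite ifN ?mulr1 //; apply: contraNneq newl => El.
have rl := ltn_ord r; rewrite (leq_ltn_trans _ rl) //= eqn_leq monoE ?leq_pred //=.
by rewrite El -Er monoE // -ltnS prednK // (leq_ltn_trans _ rl).
Qed.

End ColumnWeight.

(** * Sums over reverse plane partitions, compared fibre by fibre *)

Section RppSum.

Import GRing.Theory.
Local Open Scope ring_scope.

(** [pi] chooses a representative in each fibre, and [f z], with inverse [g], parametrizes the fibre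
    of a representative [z] by [Q z]. *)
Lemma eq_sum_fibers (R : nmodType) (X Y : finType) (P : pred X) (pi : X -> X)
    (Q : X -> pred Y) (f : X -> Y -> X) (g : X -> Y) (F F' : X -> R) :
  (forall x, P x -> [/\ P (pi x), pi (pi x) = pi x, Q (pi x) (g x) & f (pi x) (g x) = x]) ->
  (forall z y, P z -> pi z = z -> Q z y -> [/\ P (f z y), pi (f z y) = z & g (f z y) = y]) ->
  (forall z, P z -> pi z = z -> \sum_(y | Q z y) F (f z y) = \sum_(y | Q z y) F' (f z y)) ->
  \sum_(x | P x) F x = \sum_(x | P x) F' x.
Proof.
move=> pi_x fz eqF.
have fiber (G : X -> R) : \sum_(x | P x) G x =
    \sum_(z | P z && (pi z == z)) \sum_(y | Q z y) G (f z y).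
  rewrite (partition_big pi (fun z => P z && (pi z == z))) =>
    [|x /pi_x[-> -> _ _]]; last exact: eqxx.
  apply: eq_bigr => z /andP[Pz /eqP piz].
  rewrite (reindex_onto (f z) g) => [|x /andP[/pi_x[_ _ _ fx] /eqP <-]]; last exact: fx.
  apply: eq_bigl => y; apply/idP/idP => [/andP[/andP[Pf /eqP pif] /eqP gf]|Qy].
    by have [_ _] := pi_x _ Pf; rewrite pif gf.
  by have [-> -> ->] := fz _ _ Pz piz Qy; rewrite !eqxx.
by rewrite !fiber; apply: eq_bigr => z /andP[Pz /eqP]; exact: eqF.
Qed.

Lemma big_ord_trim (R : comPzRingType) (p m : nat) (G : nat -> R) : (p <= m)%N ->
  (forall c, (p <= c)%N -> G c = 1) -> \prod_(c < m) G c = \prod_(c < p) G c.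
Proof.
move=> pm G1; rewrite (big_ord_widen _ _ pm) [RHS]big_mkcond; apply: eq_bigr => c _.
by case: ltnP => // /G1.
Qed.

Variables (la : seq nat) (n : nat).
Hypothesis la_part : is_partition la.

(** The polynomial at arbitrary weights, so that permuting variables becomes a change of weights.
    The index shift matches [step_weight]. *)
Definition rpp_sum (R : comPzRingType) (xx tt : nat -> R) : R :=
  \sum_(T : filling la n | is_rpp T)
     (\prod_(r < (size la).-1) tt r.+1 ^+ equal_below T r)
   * (\prod_(k < n) xx k ^+ cols_containing T k).

Lemma eq_rpp_sum (R : comPzRingType) (xx xx' tt tt' : nat -> R) :
  xx =1 xx' -> tt =1 tt' -> rpp_sum xx tt = rpp_sum xx' tt'.
Proof.
move=> eqx eqt; apply: eq_bigr => T _.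
by congr (_ * _); apply: eq_bigr => j _; rewrite ?eqx ?eqt.
Qed.

Lemma rpp_sumE (R : comPzRingType) (xx tt : nat -> R) :
  rpp_sum xx tt = \sum_(T : filling la n | is_rpp T)
    \prod_(c < head 0%N la) \prod_(r < size la) step_weight n xx tt (entry T ^~ c) r.
Proof.
apply: eq_bigr => T /(rppP la_part) monoT.
under eq_bigr do rewrite (equal_belowE la_part) -prodr_const big_mkcond.
under [X in _ * X]eq_bigr do rewrite cols_containingE -prodr_const big_mkcond.
rewrite exchange_big [X in _ * X]exchange_big -big_split.
apply: eq_bigr => c _ /=; rewrite -prod_step_weight => [|r r' rr']; last exact: monoT.
by congr (_ * _); apply: eq_bigr => j _; rewrite inE.
Qed.

(** * Varying one row between its neighbours *)

Section VaryRow.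

Variables (i : nat) (li : (i.+1 < size la)%N) (la_i : nth 0%N la i = nth 0%N la i.+1).

Implicit Types (T z : filling la n) (y : {ffun 'I_(nth 0%N la i) -> 'I_n}).

Definition set_row z y : filling la n :=
  [ffun b => if row_of b == i then oapp y (z b) (insub (col_of b)) else z b].

Lemma entry_set_row z y r c :
  entry (set_row z y) r c =
  if r == i then oapp (fun c => y c : nat) n (insub c) else entry z r c.
Proof.
have [cr|rc] := ltnP c (nth 0%N la r); last first.
  rewrite !entry_out //; case: eqP => // ri; rewrite insubF //.
  by rewrite -ri ltnNge rc.
have [b <- <-] := box_at cr.
rewrite !entry_box ffunE; case: eqP => // rb; rewrite insubT ?insubT //.
by rewrite -rb col_lt.
Qed.

Definition get_row T r (lr : (r < size la)%N) (lar : (nth 0 la i <= nth 0 la r)%N) :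
    {ffun 'I_(nth 0%N la i) -> 'I_n} :=
  [ffun c => T (Tagged (fun r : 'I_(size la) => 'I_(nth 0%N la r))
                       (i := Ordinal lr) (widen_ord lar c))].

Lemma entry_get_row T r lr lar c : get_row T (r := r) lr lar c = entry T r c :> nat.
Proof. by rewrite ffunE -entry_box. Qed.

Let get_i T := get_row T (ltnW li) (leqnn _).
Let get_i1 T := get_row T li (eq_leq la_i).
(** The representative of a fibre has the largest possible row [i], a copy of the row below; equal
    lengths make the copy fit. *)
Let proj T := set_row T (get_i1 T).
Let above T c := if i == 0%N then 0%N else entry T i.-1 c.
Let below T c := entry T i.+1 c.

Lemma entry_set_get_row T z r' lr lar r c : nth 0%N la r' = nth 0%N la i ->
  entry (set_row z (get_row T (r := r') lr lar)) r c =
  if r == i then entry T r' c else entry z r c.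
Proof.
move=> r'i; rewrite entry_set_row; case: eqP => // ri.
case: insubP => [c' _ <-|] /=; first by rewrite entry_get_row.
by rewrite -leqNgt => ic; rewrite entry_out // r'i.
Qed.

Lemma vary_row (R : comPzRingType) (F F' : filling la n -> R) :
  (forall z, is_rpp z ->
    \sum_(y | bounded_chain (above z) (below z) y) F (set_row z y) =
    \sum_(y | bounded_chain (above z) (below z) y) F' (set_row z y)) ->
  \sum_(T | is_rpp T) F T = \sum_(T | is_rpp T) F' T.
Proof.
move=> eqF.
have entry_proj T r c : entry (proj T) r c =
    if r == i then entry T i.+1 c else entry T r c.
  exact: entry_set_get_row.
apply: (eq_sum_fibers (pi := proj) (Q := fun z => bounded_chain (above z) (below z))
          (f := set_row) (g := get_i)) => [T rppT|z y rppz projz|z rppz _]; last exact: eqF.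
  have /(rppP la_part) mT := rppT.
  have i1 : (i.+1 == i) = false by lia.
  have i_1 : i != 0%N -> (i.-1 == i) = false by lia.
  split.
  - apply/(rppP la_part) => r r' c c' rr' cc'; rewrite !entry_proj.
    by case: ifP => [/eqP ri|/eqP ri]; case: ifP => [/eqP ri'|/eqP ri']; apply: mT => //; lia.
  - by apply: eq_entry => r c _; rewrite !entry_proj i1; case: eqP.
  - apply/andP; split; apply/forallP => c.
      rewrite /above /below !entry_proj i1 entry_get_row.
      apply/andP; split; last by apply: mT.
      by case: eqP => // /eqP i0; rewrite i_1 // mT // leq_pred.
    by apply/forallP => c'; apply/implyP => cc'; rewrite !entry_get_row mT.
  - by apply: eq_entry => r c _; rewrite entry_set_get_row // entry_proj; case: eqP => // ->.
move=> /andP[/forallP y_in /forallP y_mono].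
have /(rppP la_part) mz := rppz.
have zi c : entry z i c = entry z i.+1 c by rewrite -{1}projz entry_proj eqxx.
split.
- apply/(rppP la_part) => r r' c c' rr' cc'; rewrite !entry_set_row.
  case: ifP => [/eqP ri|/eqP ri]; case: ifP => [/eqP ri'|/eqP ri'].
  + case: (insubP _ c') => [d' _ dc'|_] /=; last by case: insub => //= d; exact: ltnW.
    have dn : (c < nth 0 la i)%N by rewrite (leq_ltn_trans cc') // -dc' ltn_ord.
    rewrite insubT /=; have /forallP/(_ d')/implyP := y_mono (Sub c dn).
    by rewrite /= dc'; exact.
  + case: insubP => [d _ dc|ic] /=.
      have /andP[_] := y_in d; rewrite dc => /leq_trans; apply; apply: mz => //; lia.
    rewrite [entry z r' c']entry_out // (leq_trans (part_anti la_part rr')) // ri.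
    by rewrite (leq_trans _ cc') // leqNgt.
  + case: insubP => [d _ dc|ic] /=; last exact: entry_le.
    have /andP[+ _] := y_in d; rewrite dc /above ifN; last lia.
    by apply: leq_trans; apply: mz => //; lia.
  + exact: mz.
- apply: eq_entry => r c _; rewrite entry_proj !entry_set_row.
  by case: eqP => // ->; rewrite ifN ?zi //; lia.
- by apply/ffunP => c; apply: val_inj; rewrite /= entry_get_row entry_set_row eqxx valK.
Qed.

(** In a column with bounds a < b, rows [i] and [i.+1] contribute [tt i * xx b] if y = a,
    [xx b * tt i.+1] if y = b, and [xx y * xx b] in between; if a = b they contribute
    [tt i * tt i.+1]. Taking out [xx b] leaves weights common to all columns, as
    [sum_bounded_chainC] requires. For [i = 0], read [xx 0] for [tt i]. *)
Lemma rpp_sum_swap_rows (R : comPzRingType) (xx xx' tt tt' : nat -> R) :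
  (forall v, (0 < v)%N || (0 < i)%N -> xx v = xx' v) ->
  (forall r, (0 < r)%N -> r != i -> r != i.+1 -> tt r = tt' r) ->
  (if i == 0%N then xx 0%N else tt i) = tt' i.+1 ->
  (if i == 0%N then xx' 0%N else tt' i) = tt i.+1 ->
  rpp_sum xx tt = rpp_sum xx' tt'.
Proof.
move=> eqx eqt swap swap'; rewrite !rpp_sumE; apply: vary_row => z rppz.
have /(rppP la_part) mz := rppz.
pose rest (u v : nat -> R) c :=
  \prod_(r < size la | (r != i :> nat) && (r != i.+1 :> nat)) step_weight n u v (entry z ^~ c) r.
(* For [i = 0] and distinct bounds the lower one is 0, so [below z c] is positive and [xx 0] does
   not enter [base]. *)
pose base c := if above z c == below z c then 1 else xx (below z c).
have fact (u v : nat -> R) y : bounded_chain (above z) (below z) y ->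
    (forall w, (0 < w)%N || (0 < i)%N -> u w = xx w) ->
    \prod_(c < head 0%N la) \prod_(r < size la)
       step_weight n u v (entry (set_row z y) ^~ c) r =
    (\prod_(c < head 0%N la) rest u v c) *
    ((\prod_(c < nth 0%N la i) base c) *
    \prod_(c < nth 0%N la i)
       end_weight xx ((if i == 0%N then u 0%N else v i) * v i.+1)
         (if i == 0%N then u 0%N else v i) (v i.+1) (above z c) (below z c) (y c)).
  move=> /andP[/forallP y_in _] ux.
  rewrite -big_split /=.
  have two c : \prod_(r < size la) step_weight n u v (entry (set_row z y) ^~ c) r =
      rest u v c * (step_weight n u v (entry (set_row z y) ^~ c) i
                    * step_weight n u v (entry (set_row z y) ^~ c) i.+1).
    rewrite (bigD1 (Ordinal (ltnW li))) //= (bigD1 (Ordinal li)) /=; last first.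
      by rewrite -val_eqE /=; lia.
    rewrite mulrA mulrC; congr (_ * _); apply: eq_big => [r|r /andP[]].
      by rewrite -!val_eqE.
    rewrite -!val_eqE /= => ri ri1; rewrite /step_weight !entry_set_row (negbTE ri).
    have r1 : (0 < r)%N -> (r.-1 == i) = false by lia.
    by case: (ltnP 0 r) => //= /r1->.
  rewrite (eq_bigr _ (fun (c : 'I_(head 0%N la)) _ => two c)) big_split /=; congr (_ * _).
  rewrite (@big_ord_trim _ (nth 0%N la i) _ (fun c =>
    step_weight n u v (entry (set_row z y) ^~ c) i *
    step_weight n u v (entry (set_row z y) ^~ c) i.+1)) ?part_le_head //; last first.
    move=> c ic; rewrite /step_weight.
    rewrite (entry_out _ (r := i)) // (entry_out _ (r := i.+1)) -?la_i // !leqnn.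
    by rewrite mulr1.
  apply: eq_bigr => c _; have /andP[ay yb] := y_in c.
  rewrite /step_weight !entry_set_row eqxx valK /= leqNgt ltn_ord /=.
  have bn : (n <= below z c)%N = false by rewrite leqNgt entry_lt -la_i ltn_ord.
  have -> : (i.+1 == i) = false by lia.
  rewrite -/(below z c) bn /base /end_weight.
  (* For [i = 0], an entry 0 in the top row pays [u 0] as a new entry; this is read as equality with
     the bound 0 above it. *)
  rewrite [X in X * _](_ : _ =
      if above z c == y c then (if i == 0%N then u 0%N else v i) else xx (y c)); last first.
    rewrite /above; case: (posnP i) => [i0|i0].
      by rewrite /= eq_sym; case: eqP => [->//|/eqP y0]; rewrite ux // lt0n y0.
    have -> : (i.-1 == i) = false by lia.
    by rewrite /=; case: eqP => // _; rewrite ux // i0 orbT.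
  rewrite [above z c == y c]eq_sym; case: eqP => [ya|/eqP ya].
    rewrite ya; case: (above z c =P below z c) => [_|/eqP ab]; first by rewrite mul1r.
    by rewrite mulrC ux //; lia.
  have a_y : (above z c < y c)%N by rewrite ltn_neqAle eq_sym ya.
  have b0 : (0 < below z c)%N by lia.
  have -> : (above z c == below z c) = false by lia.
  by rewrite ux ?b0 //; case: eqP => [->|_] //; rewrite mulrC.
rewrite (eq_bigr _ (fun y hy => fact xx tt y hy (fun _ _ => erefl))).
rewrite [RHS](eq_bigr _ (fun y hy => fact xx' tt' y hy (fun w hw => esym (eqx w hw)))).
rewrite -!mulr_sumr; congr (_ * (_ * _)).
  apply: eq_bigr => c _; apply: eq_bigr => r /andP[ri ri1].
  rewrite /step_weight; case: ifP => // zn; case: ifP => [/andP[r0 _]|].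
    exact: eqt.
  (* A new entry below the top row exceeds the one above it, so it is positive: for [i = 0] the
     value [xx 0] does not occur in [rest]. *)
  move=> new; apply: eqx; case: (posnP r) new => [r0 _|r0 /= /eqP new].
    by apply/orP; right; move: ri; rewrite r0 lt0n eq_sym.
  by have := mz r.-1 r c c (leq_pred _) (leqnn _); lia.
rewrite swap swap' mulrC; apply: sum_bounded_chainC.
- by move=> c c' cc'; rewrite /above; case: ifP => // _; apply: mz.
- by move=> c c' cc'; apply: mz.
move=> c ci; rewrite /above entry_lt -la_i ci andbT; case: ifP => // _.
by apply: mz => //; lia.
Qed.

End VaryRow.
End RppSum.

(** * Final segments of a column, measured from its end *)

Lemma count_up (p : pred nat) (l r : nat) : {homo p : i j / i <= j >-> i ==> j} -> r < l ->
  p r = (l <= r + count p (iota 0 l)).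
Proof.
move=> pup rl; have [pr|npr] := boolP (p r).
  rewrite -{2}(subnKC (ltnW rl)) iotaD count_cat add0n.
  have /eqP -> : count p (iota r (l - r)) == size (iota r (l - r)).
    rewrite -all_count; apply/allP => j; rewrite mem_iota => /andP[rj _].
    exact: (implyP (pup _ _ rj)).
  by rewrite size_iota; lia.
rewrite -{2}(subnKC rl) iotaD count_cat add0n.
have /eqP -> : count p (iota 0 r.+1) == 0.
  rewrite -leqn0 leqNgt -has_count; apply: contra npr => /hasP[j].
  by rewrite mem_iota => /andP[_ jr]; apply: (implyP (pup _ _ _)).
by have := count_size p (iota r.+1 (l - r.+1)); rewrite size_iota; lia.
Qed.

Lemma count_threshold (l y : nat) : y <= l -> count (fun r => l <= r + y) (iota 0 l) = y.
Proof.
move=> yl; set c := count _ _.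
have cl : c <= l by rewrite -[l in _ <= l](size_iota 0 l) count_size.
have cE r : r < l -> (l <= r + y) = (l <= r + c).
  by apply: (count_up (p := fun r => l <= r + y)) => i j ij; apply/implyP; lia.
by have := cE (l - c); have := cE (l - y); lia.
Qed.

(** * Splitting the entries k of one column into k and k+1 *)

Section SplitColumn.

Import GRing.Theory.
Local Open Scope ring_scope.

Variables (R : fieldType) (n : nat) (xx tt : nat -> R).
Hypotheses (xx_neq0 : forall v, xx v != 0) (tt_neq0 : forall r, tt r != 0).

Lemma prod_if_ord (l a : nat) (B : bool) (q : nat -> R) : (B -> 0 < a <= l)%N ->
  \prod_(r < l) (if (r + a == l)%N && B then q r else 1) = if B then q (l - a)%N else 1.
Proof.
case: B => [/(_ isT) /andP[a0 al]|_]; last by rewrite big1 // => r _; rewrite andbF.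
have lal : (l - a < l)%N by lia.
rewrite (bigD1 (Ordinal lal)) //= subnK // eqxx big1 ?mulr1 // => r.
by rewrite -val_eqE /= => rla; rewrite ifN //; lia.
Qed.

(** The entries [k] of [E] fill the rows from [l - hi] to [l - lo - 1], and those from row [l - y]
    on become [k.+1]. For [lo < y < hi] this destroys the equality between row [l - y] and the row
    above, whence the division by [tt (l - y)]. That row depends on [y] alone, so the weights in
    between are common to all columns. *)
Lemma prod_step_split (l k lo hi y : nat) (E : nat -> nat) :
  {homo E : r r' / (r <= r')%N} -> (forall r, E r != k.+1) -> (k.+1 < n)%N ->
  (forall r, r < l -> (k < E r) = (l <= r + lo))%N ->
  (forall r, r < l -> (k <= E r) = (l <= r + hi))%N ->
  (lo <= y <= hi)%N -> (hi <= l)%N ->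
  \prod_(r < l) step_weight n xx tt
     (fun r => if E r == k then if (l <= r + y)%N then k.+1 else k else E r) r =
  (\prod_(r < l) step_weight n
     (fun v => if (v == k) || (v == k.+1) then 1 else xx v) tt E r) *
  end_weight (fun v => xx k * xx k.+1 / tt (l - v)%N) 1 (xx k) (xx k.+1) lo hi y.
Proof.
move=> monoE Ek1 kn Elo Ehi /andP[loy yhi] hil.
set F := fun r => if E r == k then _ else _.
(* Only two rows change weight: [l - hi], the first [k] of [E], gains [xx k]; [l - y], the first
   [k.+1], gains [xx k.+1] and loses its [tt]. If [y = hi] they coincide and the division by [xx k]
   cancels the first gain. *)
have stepF (r : 'I_l) : step_weight n xx tt F r =
    step_weight n (fun v => if (v == k) || (v == k.+1) then 1 else xx v) tt E r *
    ((if (r + hi == l)%N && (lo < hi)%N then xx k else 1) *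
     (if (r + y == l)%N && (lo < y)%N
      then xx k.+1 / (if y == hi then xx k else tt r) else 1)).
  have rl := ltn_ord r.
  have rlo := Elo r rl; have rhi := Ehi r rl.
  have plo := Elo r.-1 (leq_ltn_trans (leq_pred r) rl).
  have phi := Ehi r.-1 (leq_ltn_trans (leq_pred r) rl).
  have mE := monoE _ _ (leq_pred r); have E1 := Ek1 r; have E1' := Ek1 r.-1.
  rewrite /step_weight /F; have [Erk|Erk] := eqVneq (E r) k; last first.
    rewrite [in RHS](_ : (r + hi == l)%N && (lo < hi)%N = false); last by lia.
    rewrite [in RHS](_ : (r + y == l)%N && (lo < y)%N = false); last by lia.
    rewrite (negbTE E1) /= !mulr1; case: (n <= E r)%N => //.
    case: (E r.-1 =P k) => [->|//]; case: (l <= _ + y)%N => //.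
    by rewrite !(eq_sym _ (E r)) (negbTE E1) (negbTE Erk).
  rewrite Erk; have -> : (n <= k)%N = false by lia.
  have -> : (n <= (if l <= r + y then k.+1 else k))%N = false by case: ifP; lia.
  have [old|new] := boolP ((0 < r)%N && (E r.-1 == k)); last first.
    rewrite (_ : (r + hi == l)%N && (lo < hi)%N); last by lia.
    rewrite ifN; last first.
      apply/negP => /andP[r0]; have ltk : (E r.-1 < k)%N by lia.
      by rewrite (ltn_eqF ltk); case: ifP; lia.
    case: (leqP l (r + y)) => b1; last first.
      rewrite (_ : (r + y == l)%N && (lo < y)%N = false); last by lia.
      by rewrite mul1r mulr1.
    rewrite (_ : (r + y == l)%N && (lo < y)%N); last by lia.
    rewrite (_ : y == hi); last by lia.
    by rewrite mul1r mulrCA divff ?mulr1.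
  have /andP[r0 /eqP Erk'] := old.
  rewrite (_ : (r + hi == l)%N && (lo < hi)%N = false) ?mul1r; last by lia.
  rewrite r0 Erk' eqxx /=; case: (ltngtP l (r + y)) => b1.
  - by rewrite (_ : (l <= r.-1 + y)%N) ?eqxx ?mulr1 //; lia.
  - by rewrite (_ : (l <= r.-1 + y)%N = false) ?eqxx ?mulr1 //; lia.
  rewrite (_ : (l <= r.-1 + y)%N = false); last by lia.
  rewrite (_ : (lo < y)%N); last by lia.
  rewrite (_ : (y == hi) = false); last by lia.
  by rewrite (ltn_eqF (ltnSn k)) mulrCA divff ?mulr1.
rewrite (eq_bigr _ (fun r _ => stepF r)) big_split; congr (_ * _).
rewrite big_split (prod_if_ord (fun=> xx k)) /= => [|lohi]; last by lia.
rewrite (prod_if_ord (fun r => xx k.+1 / (if y == hi then xx k else tt r))) => [|lo_y]; last by lia.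
rewrite /end_weight; case: (ltngtP lo hi) => [lohi|?|lohi]; last first.
- by rewrite (_ : (lo < y)%N = false) ?mulr1 //; lia.
- by lia.
case: (ltngtP lo y) => [lo_y|?|_]; [|by lia|by rewrite mulr1].
by case: eqP => // _; [rewrite mulrCA divff ?mulr1|rewrite mulrA].
Qed.

End SplitColumn.

(** * Exchanging the variables of two consecutive entries *)

Section SwapEntries.

Import GRing.Theory.
Local Open Scope ring_scope.

Variables (la : seq nat) (n : nat).
Hypothesis la_part : is_partition la.
Variables (k1 k2 : 'I_n) (k2E : k2 = k1.+1 :> nat).

Local Notation l := (size la).
Local Notation m := (head 0%N la).
Implicit Types (T z : filling la n) (y : {ffun 'I_m -> 'I_l.+1}).

(* A tableau is recovered from its merging and from the number [y c] of entries [k2]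
   in column [c].  The bounds of [y c] count the positions of the column, outside the
   shape included, as does [l <= row + y c]: both are measured from row [l]. *)
Definition merge_entries T : filling la n := [ffun b => if T b == k2 then k1 else T b].

Definition split_entries z y : filling la n :=
  [ffun b => if z b == k1 then
     if (l <= row_of b + y (Ordinal (leq_trans (col_lt b) (part_le_head la_part _))))%N
     then k2 else k1
   else z b].

Definition num_gt T c : nat := count (fun r => (k1 < entry T r c)%N) (iota 0 l).
Definition num_ge T c : nat := count (fun r => (k1 <= entry T r c)%N) (iota 0 l).

Lemma entry_merge_entries T r c :
  entry (merge_entries T) r c = if entry T r c == k2 then k1 : nat else entry T r c.
Proof.
have [cr|rc] := ltnP c (nth 0%N la r); last first.
  by rewrite !entry_out //; case: eqP => // nk; have := ltn_ord k2; lia.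
have [b <- <-] := box_at cr.
by rewrite !entry_box ffunE -val_eqE; case: eqP.
Qed.

Lemma entry_split_entries z y r (c : 'I_m) :
  entry (split_entries z y) r c =
  if entry z r c == k1 then if (l <= r + y c)%N then k1.+1 else k1 : nat else entry z r c.
Proof.
have [cr|rc] := ltnP c (nth 0%N la r); last first.
  by rewrite !entry_out //; case: eqP => // nk; have := ltn_ord k1; lia.
have [b rb cb] := box_at cr.
rewrite -rb -cb !entry_box ffunE -val_eqE; case: eqP => // _.
rewrite (_ : Ordinal _ = c); last by apply: val_inj.
by case: ifP.
Qed.

Lemma entry_head_out T r c : (m <= c)%N -> entry T r c = n.
Proof. by move=> mc; apply: entry_out; apply: leq_trans mc; apply: part_le_head. Qed.

Lemma num_gtP T r c : is_rpp T -> (r < l)%N -> (k1 < entry T r c)%N = (l <= r + num_gt T c)%N.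
Proof.
move=> /(rppP la_part) mT; apply: (count_up (p := fun r => (k1 < entry T r c)%N)) => i j ij.
by apply/implyP => /leq_trans; apply; apply: mT.
Qed.

Lemma num_geP T r c : is_rpp T -> (r < l)%N -> (k1 <= entry T r c)%N = (l <= r + num_ge T c)%N.
Proof.
move=> /(rppP la_part) mT; apply: (count_up (p := fun r => (k1 <= entry T r c)%N)) => i j ij.
by apply/implyP => /leq_trans; apply; apply: mT.
Qed.

Lemma num_gt_le T c : (num_gt T c <= l)%N.
Proof. by rewrite -[l in leqRHS](size_iota 0) count_size. Qed.

Lemma num_ge_le T c : (num_ge T c <= l)%N.
Proof. by rewrite -[l in leqRHS](size_iota 0) count_size. Qed.

Definition column_splits T : {ffun 'I_m -> 'I_l.+1} := [ffun c : 'I_m => inord (num_gt T c)].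

Lemma column_splitsE T c : column_splits T c = num_gt T c :> nat.
Proof. by rewrite ffunE inordK // ltnS num_gt_le. Qed.

Lemma num_gt_mono T : is_rpp T -> {homo num_gt T : c c' / (c <= c')%N}.
Proof.
move=> /(rppP la_part) mT c c' cc'; apply: sub_count => r /= /leq_trans; apply.
exact: mT.
Qed.

Lemma num_ge_mono T : is_rpp T -> {homo num_ge T : c c' / (c <= c')%N}.
Proof.
move=> /(rppP la_part) mT c c' cc'; apply: sub_count => r /= /leq_trans; apply.
exact: mT.
Qed.

Lemma num_gt_ge T c : (num_gt T c <= num_ge T c)%N.
Proof. by apply: sub_count => r /= /ltnW. Qed.

Lemma eq_entry_head T T' :
  (forall r (c : 'I_m), (r < l)%N -> entry T r c = entry T' r c) -> T = T'.
Proof.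
move=> eqTT'; apply: eq_entry => r c cr.
have cm := leq_trans cr (part_le_head la_part r).
apply: (eqTT' r (Ordinal cm)); rewrite ltnNge; apply: contraTN cr => lr.
by rewrite nth_default.
Qed.

(** Both moving down and moving right, where [y] increases, preserve [l <= r + y c]; so the new [k2]
    form a part of the [k1] cells closed in both directions. *)
Lemma rpp_split_entries z y :
  is_rpp z -> bounded_chain (num_gt z) (num_ge z) y -> merge_entries z = z ->
  is_rpp (split_entries z y).
Proof.
move=> rppz /andP[_ /forallP y_mono] zfix; apply/(rppP la_part) => r r' c c' rr' cc'.
have [mc|c'm] := leqP m c'; first by rewrite [leqRHS]entry_head_out // entry_le.
have -> : c = Ordinal (leq_ltn_trans cc' c'm) by [].
rewrite -[c']/(Ordinal c'm : nat) !entry_split_entries.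
have /forallP/(_ (Ordinal c'm)) := y_mono (Ordinal (leq_ltn_trans cc' c'm)).
rewrite [(_ <= _)%N in X in X -> _]/= cc' /=.
set u := y _; set v := y _ => uv.
have /(rppP la_part)/(_ _ _ _ _ rr' cc') zz := rppz.
have z'k : entry z r' c' != k1.+1.
  have := entry_merge_entries z r' c'; rewrite zfix k2E; case: eqP => // ->; lia.
case: (entry z r c =P k1) => [zr|zr]; case: (entry z r' c' =P k1) => [zr'|zr'] //.
- by case: ifP; case: ifP; lia.
- by case: ifP; lia.
- by case: ifP; lia.
Qed.

Lemma vary_entries (R : comPzRingType) (F F' : filling la n -> R) :
  (forall z, is_rpp z -> (forall r c, entry z r c != k1.+1) ->
    \sum_(y | bounded_chain (num_gt z) (num_ge z) y) F (split_entries z y) =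
    \sum_(y | bounded_chain (num_gt z) (num_ge z) y) F' (split_entries z y)) ->
  \sum_(T | is_rpp T) F T = \sum_(T | is_rpp T) F' T.
Proof.
have neq_merge z r c : merge_entries z = z -> entry z r c != k1.+1.
  move=> zfix; have := entry_merge_entries z r c; rewrite zfix k2E; case: eqP => // ->; lia.
move=> eqF; apply: (eq_sum_fibers (pi := merge_entries)
    (Q := fun z => bounded_chain (num_gt z) (num_ge z)) (f := split_entries) (g := column_splits))
  => [T rppT|z y rppz zfix chain_y|z rppz zfix]; last first.
- by apply: eqF => // r c; exact: neq_merge.
- split; first exact: rpp_split_entries.
    apply: eq_entry_head => r c _; rewrite entry_merge_entries entry_split_entries k2E.
    have := neq_merge z r c zfix.
    by case: (entry z r c =P k1) => [->|_ /negbTE->//]; case: (l <= _)%N;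
      rewrite ?eqxx ?(ltn_eqF (ltnSn k1)).
  (* In column [c] of the split tableau the entries above [k1] are those in the rows with
     [l <= r + y c], and there are [y c] such rows. *)
  apply/ffunP => c; apply: val_inj.
  rewrite /= column_splitsE -[RHS](@count_threshold l) ?leq_ord //.
  apply: eq_in_count => r; rewrite mem_iota add0n => /andP[_ rl] /=.
  have /andP[/forallP/(_ c) y_in _] := chain_y.
  have gtE := num_gtP c rppz rl; have geE := num_geP c rppz rl.
  rewrite entry_split_entries; have nk := neq_merge z r c zfix.
  by case: eqP => zk; [case: ifP|]; lia.
have rppM : is_rpp (merge_entries T).
  have /(rppP la_part) mT := rppT.
  apply/(rppP la_part) => r r' c c' rr' cc'; rewrite !entry_merge_entries.
  by have := mT _ _ _ _ rr' cc'; case: eqP; case: eqP; lia.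
split=> //.
- by apply: eq_entry => r c _; rewrite !entry_merge_entries; case: eqP => //; case: eqP; lia.
- apply/andP; split; apply/forallP => c; last first.
    by apply/forallP => c'; apply/implyP => cc'; rewrite !column_splitsE num_gt_mono.
  rewrite column_splitsE; apply/andP; split; apply: sub_count => r /=; rewrite entry_merge_entries.
    by case: eqP; lia.
  by case: eqP; lia.
apply: eq_entry_head => r c rl; rewrite entry_split_entries entry_merge_entries column_splitsE.
rewrite -num_gtP //; case: (entry T r c =P k2) => [->|Tk2].
  by rewrite eqxx k2E ltnSn.
by case: (entry T r c =P k1) => [->|//]; rewrite ltnn.
Qed.

(** The merged tableau, with both variables set to 1, gives a common factor. Strictly between the
    bounds the weights are already symmetric in the two variables; at the bounds they are
    exchanged. *)
Lemma rpp_sum_swap_entries (R : fieldType) (xx xx' tt : nat -> R) :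
  (forall v, xx v != 0) -> (forall v, xx' v != 0) -> (forall r, tt r != 0) ->
  xx k1 = xx' k1.+1 -> xx k1.+1 = xx' k1 ->
  (forall v : nat, v != k1 -> v != k1.+1 -> xx v = xx' v) ->
  rpp_sum la n xx tt = rpp_sum la n xx' tt.
Proof.
move=> xx0 xx'0 tt0 swap swap' eqx; rewrite !rpp_sumE //; apply: vary_entries => z rppz zk.
have /(rppP la_part) mz := rppz.
have fact (u : nat -> R) y : bounded_chain (num_gt z) (num_ge z) y -> (forall v, u v != 0) ->
    \prod_(c < m) \prod_(r < l) step_weight n u tt (entry (split_entries z y) ^~ c) r =
    (\prod_(c < m) \prod_(r < l) step_weight n
       (fun v => if (v == k1) || (v == k1.+1) then 1 else u v) tt (entry z ^~ c) r) *
    \prod_(c < m) end_weight (fun v => u k1 * u k1.+1 / tt (l - v)%N) 1 (u k1) (u k1.+1)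
       (num_gt z c) (num_ge z c) (y c).
  move=> /andP[/forallP y_in _] u0; rewrite -big_split; apply: eq_bigr => c _ /=.
  rewrite -prod_step_split //.
  - by apply: eq_bigr => r _; rewrite /step_weight !entry_split_entries.
  - by move=> r r' rr'; apply: mz.
  - by rewrite -k2E.
  - by move=> r; exact: num_gtP.
  - by move=> r; exact: num_geP.
  - exact: num_ge_le.
rewrite (eq_bigr _ (fun y hy => fact xx y hy xx0)).
rewrite [RHS](eq_bigr _ (fun y hy => fact xx' y hy xx'0)).
rewrite -!mulr_sumr; congr (_ * _).
  apply: eq_bigr => c _; apply: eq_bigr => r _; rewrite /step_weight.
  case: ifP => // _; case: ifP => // _; case: ifP => // /negbT; rewrite negb_or => /andP[].
  exact: eqx.
rewrite swap swap' [xx' k1.+1 * _]mulrC; apply: sum_bounded_chainC.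
- exact: num_gt_mono.
- exact: num_ge_mono.
- by move=> c _; rewrite num_gt_ge ltnS num_ge_le.
Qed.

End SwapEntries.

(** * Transfer to the polynomial ring, and the transpositions *)

Section Symmetries.

Import GRing.Theory.
Local Open Scope ring_scope.

Lemma msymXU (N : nat) (R : nzRingType) (s : 'S_N) (i : 'I_N) :
  msym s ('X_i : {mpoly R[N]}) = 'X_(s i).
Proof.
rewrite msymX; congr mpolyX; apply/mnmP => j.
by rewrite mnmE !mnm1E -(can2_eq (permK s) (permKV s)) eq_sym.
Qed.

Lemma mpolyXU_neq0 (N : nat) (R : nzRingType) (i : 'I_N) : 'X_i != 0 :> {mpoly R[N]}.
Proof.
apply/eqP => /(congr1 (mcoeff U_(i))) /eqP.
by rewrite mcoeffX eqxx mcoeff0 oner_eq0.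
Qed.

Variables (la : seq nat) (n : nat).
Hypothesis la_part : is_partition la.

Local Notation N := (nvars la n).
Local Notation g := (refined_dual_grothendieck la n).
Implicit Types (s : 'S_N).

(** The values lie in the fraction field because exchanging entries divides by weights; the default
    1 keeps all of them nonzero. *)
Definition xvar_at s (v : nat) : {fraction {mpoly int[N]}} :=
  if insub v is Some k then tofrac 'X_(s (xidx la (k : 'I_n))) else 1.

Definition tvar_at s (r : nat) : {fraction {mpoly int[N]}} :=
  if r is r'.+1 then
    if insub r' is Some k then tofrac 'X_(s (tidx n (k : 'I_(size la).-1))) else 1
  else 1.

Lemma xvar_atE s (k : 'I_n) : xvar_at s k = tofrac 'X_(s (xidx la k)).
Proof. by rewrite /xvar_at valK. Qed.

Lemma tvar_atE s (k : 'I_(size la).-1) : tvar_at s k.+1 = tofrac 'X_(s (tidx n k)).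
Proof. by rewrite /tvar_at valK. Qed.

Lemma xvar_at_neq0 s v : xvar_at s v != 0.
Proof.
by rewrite /xvar_at; case: insub => [k|]; rewrite ?oner_neq0 // tofrac_eq0 mpolyXU_neq0.
Qed.

Lemma tvar_at_neq0 s r : tvar_at s r != 0.
Proof.
case: r => [|r] /=; rewrite ?oner_neq0 //.
by case: insub => [k|]; rewrite ?oner_neq0 // tofrac_eq0 mpolyXU_neq0.
Qed.

Lemma tofrac_msym s : tofrac (msym s g) = rpp_sum la n (xvar_at s) (tvar_at s).
Proof.
rewrite /refined_dual_grothendieck (rmorph_sum (msym s)) rmorph_sum; apply: eq_bigr => T _ /=.
rewrite msymM tofracM; congr (_ * _); rewrite (rmorph_prod (msym s)) rmorph_prod;
  apply: eq_bigr => j _; rewrite (rmorphXn (msym s)) rmorphXn /= msymXU; congr (_ ^+ _).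
  by rewrite -tvar_atE.
by rewrite -xvar_atE.
Qed.

Lemma msym_of_rpp_sum s :
  rpp_sum la n (xvar_at 1) (tvar_at 1) = rpp_sum la n (xvar_at s) (tvar_at s) -> msym s g = g.
Proof.
by rewrite -!tofrac_msym msym1m => /eqP; rewrite tofrac_eq => /eqP<-.
Qed.

Lemma xidx_inj : injective (@xidx la n).
Proof. exact: lshift_inj. Qed.

Lemma tidx_inj : injective (@tidx la n).
Proof. exact: rshift_inj. Qed.

Lemma xidx_neq_tidx (j : 'I_n) (k : 'I_(size la).-1) : xidx la j != tidx n k.
Proof. by rewrite eq_lrshift. Qed.

Lemma xvar_at_fix s v : (forall k : 'I_n, k = v :> nat -> s (xidx la k) = xidx la k) ->
  xvar_at s v = xvar_at 1 v.
Proof.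
by rewrite /xvar_at; case: insubP => //= k _ kv /(_ k kv) ->; rewrite perm1.
Qed.

Lemma tvar_at_fix s r :
  (forall k : 'I_(size la).-1, k.+1 = r -> s (tidx n k) = tidx n k) ->
  tvar_at s r = tvar_at 1 r.
Proof.
case: r => //= r; case: insubP => //= k _ kr /(_ k) ->; first by rewrite perm1.
by congr _.+1.
Qed.

Lemma symmetric_in_entries (k1 k2 : 'I_n) : k2 = k1.+1 :> nat ->
  symmetric_in (xidx la k1) (xidx la k2) g.
Proof.
move=> k2E; apply: msym_of_rpp_sum; set s := tperm _ _.
have fixt r : tvar_at s r = tvar_at 1 r.
  by rewrite tvar_at_fix // => k _; rewrite tpermD // xidx_neq_tidx.
rewrite [RHS](eq_rpp_sum la n (fun=> erefl) fixt).
apply: (rpp_sum_swap_entries la_part k2E).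
- exact: xvar_at_neq0.
- exact: xvar_at_neq0.
- exact: tvar_at_neq0.
- by rewrite -k2E !xvar_atE tpermR perm1.
- by rewrite -k2E !xvar_atE tpermL perm1.
- move=> v vk1 vk2; rewrite [RHS]xvar_at_fix // => k kv.
  by rewrite tpermD // (inj_eq xidx_inj) -val_eqE /=; lia.
Qed.

Section EqualRows.

Variables (i : 'I_(size la).-1) (la_i : nth 0%N la i = nth 0%N la i.+1).

Let li : (i.+1 < size la)%N.
Proof. by have := ltn_ord i; lia. Qed.

Lemma symmetric_in_rows (k : 'I_(size la).-1) : k.+1 = i -> symmetric_in (tidx n k) (tidx n i) g.
Proof.
move=> ki; have i0 : (i == 0%N :> nat) = false by rewrite -ki.
apply: msym_of_rpp_sum; apply: (@rpp_sum_swap_rows _ n la_part i li la_i {fraction {mpoly int[N]}}).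
- move=> v _; rewrite [RHS]xvar_at_fix // => k' _.
  by rewrite tpermD // eq_sym xidx_neq_tidx.
- move=> r r0 ri ri1; rewrite [RHS]tvar_at_fix // => k' k'r.
  by rewrite tpermD // (inj_eq tidx_inj) -val_eqE /=; lia.
- by rewrite i0 -{1}ki !tvar_atE tpermR perm1.
- by rewrite i0 -{1}ki !tvar_atE tpermL perm1.
Qed.

Lemma symmetric_in_row_entry0 (j : 'I_n) : i = 0%N :> nat -> j = 0%N :> nat ->
  symmetric_in (xidx la j) (tidx n i) g.
Proof.
move=> i0 j0; apply: msym_of_rpp_sum.
apply: (@rpp_sum_swap_rows _ n la_part i li la_i {fraction {mpoly int[N]}}).
- move=> v; rewrite i0 orbF => v0; rewrite [RHS]xvar_at_fix // => k' k'v.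
  by rewrite tpermD // 1?eq_sym ?xidx_neq_tidx // (inj_eq xidx_inj) -val_eqE /=; lia.
- move=> r r0 ri ri1; rewrite [RHS]tvar_at_fix // => k' k'r.
  by rewrite tpermD // ?xidx_neq_tidx // (inj_eq tidx_inj) -val_eqE /=; lia.
- rewrite ifT; last by rewrite i0.
  by rewrite -[0%N in LHS]j0 xvar_atE tvar_atE tpermR perm1.
- rewrite ifT; last by rewrite i0.
  by rewrite -[0%N in LHS]j0 xvar_atE tvar_atE tpermL perm1.
Qed.

Lemma symmetric_in_row_entry (j : 'I_n) : i = 0%N :> nat ->
  symmetric_in (xidx la j) (tidx n i) g.
Proof.
move=> i0; case: j => j; elim: j => [|j IHj] jn; first exact: symmetric_in_row_entry0.
set j' := Ordinal jn; pose j1 : 'I_n := Ordinal (ltnW jn).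
have sym_t : msym (tperm (xidx la j1) (tidx n i)) g = g by exact: IHj.
have sym_x : msym (tperm (xidx la j1) (xidx la j')) g = g by exact: symmetric_in_entries.
rewrite /symmetric_in.
(* Conjugation by an adjacent exchange of entries carries the previous variable to the next and
   fixes the [t] variable. *)
have -> : tperm (xidx la j') (tidx n i) =
    (tperm (xidx la j1) (tidx n i) ^ tperm (xidx la j1) (xidx la j'))%g.
  by rewrite tpermJ tpermL tpermD ?xidx_neq_tidx.
by rewrite conjgE tpermV !msymMm sym_x sym_t sym_x.
Qed.

End EqualRows.
End Symmetries.

Theorem corollary3p17 (la : seq nat) (n : nat) (i : 'I_(size la).-1) :
  is_partition la ->
  nth 0 la i = nth 0 la i.+1 ->
  (forall k : 'I_(size la).-1, k.+1 = i ->
     symmetric_in (tidx n k) (tidx n i) (refined_dual_grothendieck la n))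
  /\
  ((i : nat) = 0 -> forall j : 'I_n, j.+1 < size la ->
     symmetric_in (xidx la j) (tidx n i) (refined_dual_grothendieck la n)).
Proof.
move=> la_part la_i; split=> [k ki|i0 j _]; first exact: symmetric_in_rows.
exact: symmetric_in_row_entry.
Qed.
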